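(* Let $(\mathcal{A},\cdot,\alpha)$ be a Hom-alternative superalgebra and let $R:\mathcal{A}\to\mathcal{A}$ be a Rota-Baxter operator of weight $\lambda\in\mathbb{K}$ on $\mathcal{A}$. Define, for all $x,y\in\mathcal{H}(\mathcal{A})$, $$x\prec y=x\cdot R(y),\qquad x\succ y=R(x)\cdot y,\qquad x\circ y=\lambda\, x\cdot y .$$ Then $(\mathcal{A},\prec,\succ,\circ,\alpha)$ is a Hom-post-alternative superalgebra (with $\circ$ playing the role of the third operation).
   Context: $\mathbb{K}$ is an algebraically closed field of characteristic $0$; all vector spaces are finite-dimensional over $\mathbb{K}$. For a $\mathbb{Z}_2$-graded vector space $\mathcal{A}=\mathcal{A}_0\oplus\mathcal{A}_1$, $\mathcal{H}(\mathcal{A})$ denotes the set of homogeneous elements and $|x|$ the degree of $x\in\mathcal{H}(\mathcal{A})$. A linear or bilinear map is even if it preserves the grading. A Hom-superalgebra $(\mathcal{A},\cdot,\alpha)$ is a $\mathbb{Z}_2$-graded vector space with an even bilinear map $\cdot:\mathcal{A}\times\mathcal{A}\to\mathcal{A}$ and an even linear map $\alpha:\mathcal{A}\to\mathcal{A}$. All Hom-superalgebras are assumed multiplicative: $\alpha(x\cdot y)=\alpha(x)\cdot\alpha(y)$ (for structures with several operations, this holds for each operation). The Hom-associator is $as_{\mathcal{A}}(x,y,z)=(x\cdot y)\cdot\alpha(z)-\alpha(x)\cdot(y\cdot z)$. A Hom-superalgebra is Hom-alternative if for all $x,y,z\in\mathcal{H}(\mathcal{A})$: $as_{\mathcal{A}}(x,y,z)+(-1)^{|x||y|}as_{\mathcal{A}}(y,x,z)=0$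 and $as_{\mathcal{A}}(x,y,z)+(-1)^{|y||z|}as_{\mathcal{A}}(x,z,y)=0$. A Rota-Baxter operator of weight $\lambda\in\mathbb{K}$ on a Hom-alternative superalgebra $(\mathcal{A},\cdot,\alpha)$ is an even linear map $R:\mathcal{A}\to\mathcal{A}$ commuting with $\alpha$ such that $R(x)\cdot R(y)=R\big(R(x)\cdot y+x\cdot R(y)+\lambda\,x\cdot y\big)$ for all $x,y\in\mathcal{H}(\mathcal{A})$. A Hom-post-alternative superalgebra is a tuple $(\mathcal{A},\prec,\succ,\cdot,\alpha)$ where $\mathcal{A}$ is a $\mathbb{Z}_2$-graded vector space, $\prec,\succ,\cdot$ are even bilinear maps $\mathcal{A}\times\mathcal{A}\to\mathcal{A}$ and $\alpha$ is an even linear map such that, writing $x\bullet y=x\succ y+x\prec y+x\cdot y$, for all $x,y,z\in\mathcal{H}(\mathcal{A})$: (1) $(x\cdot y)\cdot\alpha(z)-\alpha(x)\cdot(y\cdot z)+(-1)^{|x||y|}(y\cdot x)\cdot\alpha(z)-(-1)^{|x||y|}\alpha(y)\cdot(x\cdot z)=0$; (2) $(x\cdot y)\cdot\alpha(z)-\alpha(x)\cdot(y\cdot z)+(-1)^{|y||z|}(x\cdot z)\cdot\alpha(y)-(-1)^{|y||z|}\alpha(x)\cdot(z\cdot y)=0$; (3) $(x\cdot y)\prec\alpha(z)-\alpha(x)\cdot(y\prec z)+(-1)^{|x||y|}(y\cdot x)\prec\alpha(z)-(-1)^{|x||y|}\alpha(y)\cdot(x\prec z)=0$; (4) $(x\succ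 y)\cdot\alpha(z)-\alpha(x)\succ(y\cdot z)+(-1)^{|y||z|}(x\succ z)\cdot\alpha(y)-(-1)^{|y||z|}\alpha(x)\succ(z\cdot y)=0$; (5) $(y\succ x)\cdot\alpha(z)-\alpha(y)\succ(x\cdot z)+(-1)^{|x||y|}(x\prec y)\cdot\alpha(z)-(-1)^{|x||y|}\alpha(x)\cdot(y\succ z)=0$; (6) $(z\prec x)\cdot\alpha(y)-\alpha(z)\cdot(x\succ y)+(-1)^{|x||y|}(z\cdot y)\prec\alpha(x)-(-1)^{|x||y|}\alpha(z)\cdot(y\prec x)=0$; (7) $(x\succ y)\prec\alpha(z)-\alpha(x)\succ(y\prec z)+(-1)^{|x||y|}(y\prec x)\prec\alpha(z)-(-1)^{|x||y|}\alpha(y)\prec(x\bullet z)=0$; (8) $(x\succ y)\prec\alpha(z)-\alpha(x)\succ(y\prec z)+(-1)^{|y||z|}(x\bullet z)\succ\alpha(y)-(-1)^{|y||z|}\alpha(x)\succ(z\succ y)=0$; (9) $(x\bullet y)\succ\alpha(z)-\alpha(x)\succ(y\succ z)+(-1)^{|x||y|}(y\bullet x)\succ\alpha(z)-(-1)^{|x||y|}\alpha(y)\succ(x\succ z)=0$; (10) $(z\prec x)\prec\alpha(y)-\alpha(z)\prec(x\bullet y)+(-1)^{|x||y|}(z\prec y)\prec\alpha(x)-(-1)^{|x||y|}\alpha(z)\prec(y\bullet x)=0$. *)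

(* Defs.v *)
From mathcomp Require Import all_boot all_algebra.

Set Implicit Arguments.
Unset Strict Implicit.
Unset Printing Implicit Defensive.

Import GRing.Theory.
Local Open Scope ring_scope.

(* The homogeneous component of degree 0 is [G false], that of degree 1 is    *)
(* [G true]; addition of degrees in Z/2 is [(+)].                             *)
Record grading (K : fieldType) (A : vectType K) := Grading {
  component :> bool -> {vspace A};
  component_sum : (component false + component true)%VS = fullv;
  component_direct : directv (component false + component true) }.

(* Quantifying over homogeneous elements x with their degree is rendered as   *)
(* [forall a x, x \in G a -> ...]. The zero vector gets both degrees, which   *)
(* is harmless: all the identities below hold trivially when x, y or z is 0.  *)
Section HomSuperalgebras.

Variables (K : fieldType) (A : vectType K) (G : grading A).
Implicit Types (mul prec succ circ : A -> A -> A) (alpha f : 'End(A)).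

Definition koszul (a b : bool) : K := (-1) ^+ (a * b)%N.

Definition even_map f := forall a x, x \in G a -> f x \in G a.

Definition even_op mul :=
  forall a b x y, x \in G a -> y \in G b -> mul x y \in G (a (+) b).

Definition multiplicative_for mul alpha :=
  forall x y, alpha (mul x y) = mul (alpha x) (alpha y).

Record hom_superalgebra mul alpha : Prop := HomSuperalgebra {
  hs_bilinear : bilinear_for *:%R *:%R mul;
  hs_even_op : even_op mul;
  hs_even_map : even_map alpha;
  hs_multiplicative : multiplicative_for mul alpha }.

Definition hom_associator mul alpha (x y z : A) : A :=
  mul (mul x y) (alpha z) - mul (alpha x) (mul y z).

Record hom_alternative mul alpha : Prop := HomAlternative {
  ha_superalgebra : hom_superalgebra mul alpha;
  ha_left : forall a b c x y z, x \in G a -> y \in G b -> z \in G c ->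
    hom_associator mul alpha x y z
    + koszul a b *: hom_associator mul alpha y x z = 0;
  ha_right : forall a b c x y z, x \in G a -> y \in G b -> z \in G c ->
    hom_associator mul alpha x y z
    + koszul b c *: hom_associator mul alpha x z y = 0 }.

Record rota_baxter mul alpha (lambda : K) (R : 'End(A)) : Prop := RotaBaxter {
  rb_even : even_map R;
  rb_comm : forall x, R (alpha x) = alpha (R x);
  rb_eq : forall a b x y, x \in G a -> y \in G b ->
    mul (R x) (R y) = R (mul (R x) y + mul x (R y) + lambda *: mul x y) }.

Definition bullet prec succ circ (x y : A) : A :=
  succ x y + prec x y + circ x y.

Section PostAlternative.

Variables (prec succ circ : A -> A -> A) (alpha : 'End(A)).

Local Notation "x ≺ y" := (prec x y) (at level 40, left associativity).
Local Notation "x ≻ y" := (succ x y) (at level 40, left associativity).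
Local Notation "x ∘ y" := (circ x y) (at level 40, left associativity).
Local Notation "x ∙ y" := (bullet prec succ circ x y)
  (at level 40, left associativity).
Local Notation α := alpha.

Record hom_post_alternative : Prop := HomPostAlternative {
  hpa_prec : hom_superalgebra prec alpha;
  hpa_succ : hom_superalgebra succ alpha;
  hpa_circ : hom_superalgebra circ alpha;
  hpa_eq1 : forall a b c x y z, x \in G a -> y \in G b -> z \in G c ->
    (x ∘ y) ∘ α z - α x ∘ (y ∘ z) + koszul a b *: ((y ∘ x) ∘ α z)
      - koszul a b *: (α y ∘ (x ∘ z)) = 0;
  hpa_eq2 : forall a b c x y z, x \in G a -> y \in G b -> z \in G c ->
    (x ∘ y) ∘ α z - α x ∘ (y ∘ z) + koszul b c *: ((x ∘ z) ∘ α y)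
      - koszul b c *: (α x ∘ (z ∘ y)) = 0;
  hpa_eq3 : forall a b c x y z, x \in G a -> y \in G b -> z \in G c ->
    (x ∘ y) ≺ α z - α x ∘ (y ≺ z) + koszul a b *: ((y ∘ x) ≺ α z)
      - koszul a b *: (α y ∘ (x ≺ z)) = 0;
  hpa_eq4 : forall a b c x y z, x \in G a -> y \in G b -> z \in G c ->
    (x ≻ y) ∘ α z - α x ≻ (y ∘ z) + koszul b c *: ((x ≻ z) ∘ α y)
      - koszul b c *: (α x ≻ (z ∘ y)) = 0;
  hpa_eq5 : forall a b c x y z, x \in G a -> y \in G b -> z \in G c ->
    (y ≻ x) ∘ α z - α y ≻ (x ∘ z) + koszul a b *: ((x ≺ y) ∘ α z)
      - koszul a b *: (α x ∘ (y ≻ z)) = 0;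
  hpa_eq6 : forall a b c x y z, x \in G a -> y \in G b -> z \in G c ->
    (z ≺ x) ∘ α y - α z ∘ (x ≻ y) + koszul a b *: ((z ∘ y) ≺ α x)
      - koszul a b *: (α z ∘ (y ≺ x)) = 0;
  hpa_eq7 : forall a b c x y z, x \in G a -> y \in G b -> z \in G c ->
    (x ≻ y) ≺ α z - α x ≻ (y ≺ z) + koszul a b *: ((y ≺ x) ≺ α z)
      - koszul a b *: (α y ≺ (x ∙ z)) = 0;
  hpa_eq8 : forall a b c x y z, x \in G a -> y \in G b -> z \in G c ->
    (x ≻ y) ≺ α z - α x ≻ (y ≺ z) + koszul b c *: ((x ∙ z) ≻ α y)
      - koszul b c *: (α x ≻ (z ≻ y)) = 0;
  hpa_eq9 : forall a b c x y z, x \in G a -> y \in G b -> z \in G c ->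
    (x ∙ y) ≻ α z - α x ≻ (y ≻ z) + koszul a b *: ((y ∙ x) ≻ α z)
      - koszul a b *: (α y ≻ (x ≻ z)) = 0;
  hpa_eq10 : forall a b c x y z, x \in G a -> y \in G b -> z \in G c ->
    (z ≺ x) ≺ α y - α z ≺ (x ∙ y) + koszul a b *: ((z ≺ y) ≺ α x)
      - koszul a b *: (α z ≺ (y ∙ x)) = 0 }.

End PostAlternative.

End HomSuperalgebras.

(* Main.v *)
Require Import Defs.
From mathcomp Require Import all_boot all_algebra.

Set Implicit Arguments.
Unset Strict Implicit.

Import GRing.Theory.
Local Open Scope ring_scope.

(** Since [R] commutes with [alpha], and [R (R x * y + x * R y + lambda x y)]
    equals [R x * R y], each of the ten axioms is one of the two alternativity
    identities (possibly scaled by a power of [lambda]) in which [R] has been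
    applied to some of the arguments. *)

Lemma koszulC (K : fieldType) (a b : bool) : koszul K a b = koszul K b a.
Proof. by rewrite /koszul mulnC. Qed.

(** In [hpa_eq1] to [hpa_eq6] all four products carry the same power of [lambda]; pulling it out
    leaves an alternativity identity. *)
Lemma scale_four_terms (K : fieldType) (A : lmodType K) (l k : K)
    (u v w t : A) :
  l *: u - l *: v + k *: (l *: w) - k *: (l *: t)
  = l *: (u - v + k *: w - k *: t).
Proof.
by rewrite scalerBr scalerDr scalerBr !scalerA (mulrC k).
Qed.

Section BilinearFor.

Variables (K : fieldType) (A : vectType K) (mul : A -> A -> A).
Hypothesis mul_bilinear : bilinear_for *:%R *:%R mul.

Lemma bilinear_forZl k x y : mul (k *: x) y = k *: mul x y.
Proof. exact: (GRing.scalable_linear (mul_bilinear.1 y)). Qed.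

Lemma bilinear_forZr k x y : mul x (k *: y) = k *: mul x y.
Proof. exact: (GRing.scalable_linear (mul_bilinear.2 x)). Qed.

Lemma bilinear_for_comp (f g : 'End(A)) (k : K) :
  bilinear_for *:%R *:%R (fun x y => k *: mul (f x) (g y)).
Proof.
split=> [y|x] c u v /=; rewrite linearP.
  by rewrite (mul_bilinear.1 (g y)) scalerDr !scalerA mulrC.
by rewrite (mul_bilinear.2 (f x)) scalerDr !scalerA mulrC.
Qed.

End BilinearFor.

Section HomAlternativeSuperalgebra.

Variables (K : fieldType) (A : vectType K) (G : grading A).
Variables (mul : A -> A -> A) (alpha : 'End(A)).

(** With [f], [g] among the identity and [R], and [k] equal to 1 or [lambda], this covers all three
    operations. Commutation with [alpha] carries multiplicativity over. *)
Lemma hom_superalgebra_comp (f g : 'End(A)) (k : K) :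
    even_map G f -> even_map G g ->
    (forall x, f (alpha x) = alpha (f x)) ->
    (forall x, g (alpha x) = alpha (g x)) ->
  hom_superalgebra G mul alpha ->
  hom_superalgebra G (fun x y => k *: mul (f x) (g y)) alpha.
Proof.
move=> evf evg fC gC [bil evm eva mulm]; split=> //.
- exact: bilinear_for_comp.
- by move=> a b x y Gx Gy; rewrite memvZ // evm ?evf ?evg.
- by move=> x y; rewrite linearZ /= mulm fC gC.
Qed.

(** Needed because [1 *: mul (\1%VF x) (R y)] and its analogues match the intended operations only
    pointwise. *)
Lemma eq_hom_superalgebra (mul' : A -> A -> A) :
    mul =2 mul' ->
  hom_superalgebra G mul alpha -> hom_superalgebra G mul' alpha.
Proof.
move=> mulE [[bl br] evm eva mulm]; split=> //.
- split=> [y|x] c u v /=; rewrite -!mulE; first exact: (bl y).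
  exact: (br x).
- by move=> a b x y Gx Gy; rewrite -mulE; apply: evm.
- by move=> x y; rewrite -!mulE.
Qed.

Hypothesis altA : hom_alternative G mul alpha.

Lemma hom_alternative_left_expanded a b c x y z :
    x \in G a -> y \in G b -> z \in G c ->
  mul (mul x y) (alpha z) - mul (alpha x) (mul y z)
  + koszul K a b *: mul (mul y x) (alpha z)
  - koszul K a b *: mul (alpha y) (mul x z) = 0.
Proof.
move=> Gx Gy Gz; rewrite -(ha_left altA Gx Gy Gz) /hom_associator.
by rewrite scalerBr addrA.
Qed.

Lemma hom_alternative_right_expanded a b c x y z :
    x \in G a -> y \in G b -> z \in G c ->
  mul (mul x y) (alpha z) - mul (alpha x) (mul y z)
  + koszul K b c *: mul (mul x z) (alpha y)
  - koszul K b c *: mul (alpha x) (mul z y) = 0.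
Proof.
move=> Gx Gy Gz; rewrite -(ha_right altA Gx Gy Gz) /hom_associator.
by rewrite scalerBr addrA.
Qed.

End HomAlternativeSuperalgebra.

Theorem proposition4p8 (K : closedFieldType) (charK : [pchar K] =i pred0)
    (A : vectType K) (G : grading A) (mul : A -> A -> A) (alpha R : 'End(A))
    (lambda : K) :
  hom_alternative G mul alpha ->
  rota_baxter G mul alpha lambda R ->
  hom_post_alternative G
    (fun x y : A => mul x (R y))
    (fun x y : A => mul (R x) y)
    (fun x y : A => lambda *: mul x y)
    alpha.
Proof.
move=> altA [evR RC RB].
have supA := ha_superalgebra altA.
have bil := hs_bilinear supA.
have mulZ := (bilinear_forZl bil, bilinear_forZr bil).
have id_even : even_map G (\1%VF : 'End(A)) by move=> a x; rewrite id_lfunE.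
have id_comm (x : A) : \1%VF (alpha x) = alpha (\1%VF x) by rewrite !id_lfunE.
have left4 := hom_alternative_left_expanded altA.
have right4 := hom_alternative_right_expanded altA.
(* [bullet] unfolds to the argument of [R] in the Rota-Baxter identity, so on homogeneous elements
   [R] turns [bullet] into [mul]. *)
have RBb a b x y : x \in G a -> y \in G b ->
    R (bullet (fun x y => mul x (R y)) (fun x y => mul (R x) y)
         (fun x y => lambda *: mul x y) x y) = mul (R x) (R y).
  by move=> Gx Gy; rewrite (RB _ _ _ _ Gx Gy).
split.
- apply: eq_hom_superalgebra (hom_superalgebra_comp 1 id_even evR id_comm RC supA).
  by move=> x y; rewrite scale1r id_lfunE.
- apply: eq_hom_superalgebra (hom_superalgebra_comp 1 evR id_even RC id_comm supA).
  by move=> x y; rewrite scale1r id_lfunE.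
- apply: eq_hom_superalgebra
    (hom_superalgebra_comp lambda id_even id_even id_comm id_comm supA).
  by move=> x y; rewrite !id_lfunE.
(* The third operation is nested in itself, so [lambda] comes out twice. *)
- move=> a b c x y z Gx Gy Gz; rewrite !mulZ !scale_four_terms.
  by rewrite (left4 a b c) ?scaler0.
- move=> a b c x y z Gx Gy Gz; rewrite !mulZ !scale_four_terms.
  by rewrite (right4 a b c) ?scaler0.
(* Left alternativity at [(x, y, R z)]; the next axiom is right alternativity at [(R x, y, z)]. *)
- move=> a b c x y z Gx Gy Gz; rewrite !mulZ !scale_four_terms !RC.
  by rewrite (left4 a b c) ?scaler0 ?evR.
- move=> a b c x y z Gx Gy Gz; rewrite !mulZ !scale_four_terms !RC.
  by rewrite (right4 a b c) ?scaler0 ?evR.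
(* The triple is [(R y, x, z)]: its first two degrees come as [b], [a], hence the swapped sign. *)
- move=> a b c x y z Gx Gy Gz; rewrite !mulZ !scale_four_terms !RC koszulC.
  by rewrite (left4 b a c) ?scaler0 ?evR.
(* Right alternativity at [(z, R x, y)]. *)
- move=> a b c x y z Gx Gy Gz; rewrite !mulZ !scale_four_terms !RC.
  by rewrite (right4 c a b) ?scaler0 ?evR.
(* This axiom and the next are left and right alternativity at the same triple [(R x, y, R z)]. *)
- move=> a b c x y z Gx Gy Gz; rewrite (RBb a c) // !RC.
  by rewrite (left4 a b c) ?evR.
- move=> a b c x y z Gx Gy Gz; rewrite (RBb a c) // !RC.
  by rewrite (right4 a b c) ?evR.
(* The last two use [(R x, R y, z)] on the left and [(z, R x, R y)] on the right; both orders of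
   [bullet] occur. *)
- move=> a b c x y z Gx Gy Gz; rewrite (RBb a b) // (RBb b a) // !RC.
  by rewrite (left4 a b c) ?evR.
- move=> a b c x y z Gx Gy Gz; rewrite (RBb a b) // (RBb b a) // !RC.
  by rewrite (right4 c a b) ?evR.
Qed.
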